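(* Let $V$ be a $\sigma$-bounded ordered vector space. Then the following are equivalent: (1) $V$ is Archimedean. (2) $V^+$ is closed in $V$ with respect to the normal topology. (3) The order on $V$ is induced by its extremal positive linear functionals. (4) The order on $V$ is induced by its positive linear functionals.
   Context: An ordered vector space is a real vector space $V$ with a partial order $\le$ (reflexive, transitive, antisymmetric) such that $v\le w$ implies $u+v\le u+w$ and $\lambda v\le\lambda w$ for all $u,v,w\in V$ and $\lambda\in[0,\infty[$. Write $V^+=\{v\in V: 0\le v\}$. $V$ is Archimedean if, whenever $v\in V$, $w\in V^+$ satisfy $v\le\epsilon w$ for all $\epsilon\in\,]0,\infty[$, then $v\le 0$. $V$ is directed if any two elements have a common upper bound. $V$ is $\sigma$-bounded if there is an increasing sequence $(\hat v_n)_{n\in\mathbb N}$ in $V^+$ such that for all $v\in V$ there is $n\in\mathbb N$ with $-\hat v_n\le v\le\hat v_n$ (in particular $V$ is then directed). A subset $S\subseteq V$ is absorbing if for every $v\in V$ there is $\lambda\in\,]0,\infty[$ with $\lambda v\in S$; balanced if $\lambda s\in S$ for all $s\in S$, $\lambda\in[-1,1]$; saturated if for all $\ell,u\in S$ with $\ell\le u$ one has $\{v\in V:\ell\le v\le u\}\subseteq S$. The normal topology on $V$ is the (not necessarily Hausdorff) locally convex topology whose filter of $0$-neighbourhoods is generated by the absorbing balanced convex and saturated subsets of $V$. Let $V^*$ be the space of all real linear functionals on $V$, with pairing $\langle\omega,v\rangle$. $\omega\in V^*$ is positive if $\langle\omega,v\rangle\ge 0$ for all $v\in V^+$; the set of these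 is $V^{*,+}$. For directed $V$, $V^*$ is ordered by $\rho\le\omega$ iff $\omega-\rho\in V^{*,+}$, and $\omega\in V^{*,+}$ is extremal if for every $\rho\in V^{*,+}$ with $\rho\le\omega$ there is $\mu\in[0,1]$ with $\rho=\mu\omega$ (so $0$ counts as extremal). The order on $V$ is induced by its (extremal) positive linear functionals if for every $v\in V\setminus V^+$ there is an (extremal) positive linear functional $\omega$ on $V$ with $\langle\omega,v\rangle<0$. *)

(* Defs.v *)
From HB Require Import structures.
From mathcomp Require Import all_boot all_order all_algebra.
From mathcomp Require Import all_classical all_reals all_analysis.

Set Implicit Arguments.
Unset Strict Implicit.
Unset Printing Implicit Defensive.

Import Order.TTheory GRing.Theory Num.Theory.
Import numFieldNormedType.Exports.

Local Open Scope classical_set_scope.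
Local Open Scope ring_scope.

HB.mixin Record POrderedLmodule_isOrderedVectSpace (R : realType) V
    & Num.POrderedZmodule V & GRing.Lmodule R V := {
  ovs_leD2l : forall u v w : V, v <= w -> u + v <= u + w ;
  ovs_leZ2l : forall (l : R) (v w : V), 0 <= l -> v <= w -> l *: v <= l *: w
}.

#[short(type="orderedVectSpace")]
HB.structure Definition OrderedVectSpace (R : realType) :=
  {V of Num.POrderedZmodule V & GRing.Lmodule R V
      & POrderedLmodule_isOrderedVectSpace R V}.

Section order_notions.
Context {R : realType} (V : orderedVectSpace R).

Definition positive_cone : set V := [set v | 0 <= v].

Definition archimedean : Prop :=
  forall v w : V, positive_cone w ->
    (forall e : R, 0 < e -> v <= e *: w) -> v <= 0.

Definition sigma_bounded : Prop :=
  exists u : nat -> V,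
    [/\ nondecreasing_seq u, forall n, positive_cone (u n)
      & forall v, exists n, - u n <= v <= u n].

Definition absorbing (S : set V) : Prop :=
  forall v, exists2 l : R, 0 < l & S (l *: v).

Definition balanced (S : set V) : Prop :=
  forall s (l : R), S s -> -1 <= l <= 1 -> S (l *: s).

Definition saturated (S : set V) : Prop :=
  forall l u, S l -> S u -> l <= u -> [set v | l <= v <= u] `<=` S.

Definition normal_base : set_system V :=
  [set S | [/\ absorbing S, balanced S,
               convex_set (S : set (convex_lmodType V)) & saturated S]].

Definition positive_functional (omega : {scalar V}) : Prop :=
  forall v, positive_cone v -> 0 <= omega v.

Definition functional_le (rho omega : {scalar V}) : Prop :=
  positive_functional (omega \- rho).

(* The zero functional is extremal. *)
Definition extremal_functional (omega : {scalar V}) : Prop :=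
  positive_functional omega /\
  forall rho : {scalar V}, positive_functional rho -> functional_le rho omega ->
    exists2 mu : R, 0 <= mu <= 1 & forall v, rho v = mu * omega v.

Definition order_induced_by (P : {scalar V} -> Prop) : Prop :=
  forall v, ~ positive_cone v -> exists2 omega, P omega & omega v < 0.

End order_notions.

Arguments positive_cone {R} V _ : assert.

(* Carrier of the normal topology: the type V together with its order and
   vector space structure, kept apart from any topology V may already have. *)
Definition order_normal_space (R : realType) (V : orderedVectSpace R) : Type :=
  V.

HB.instance Definition _ (R : realType) (V : orderedVectSpace R) :=
  OrderedVectSpace.on (order_normal_space V).

Section normal_topology.
Context {R : realType} (V : orderedVectSpace R).
Local Notation N := (order_normal_space V).

Let convex_setP (S : set V) : convex_set (S : set (convex_lmodType V)) <->
  forall x y (t : R), 0 <= t <= 1 -> S x -> S y -> S (t *: x + (1 - t) *: y).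
Proof.
split=> [cS x y t t01 Sx Sy|cS x y l /[!inE] Sx Sy]; last first.
  by apply: (cS x y l%:num) => //; rewrite ge0 le1.
case/andP: t01 => t0 t1.
have := cS x y (@Itv01 _ t t0 t1).
by rewrite !inE; apply.
Qed.

Let normal_base0 (S : set V) : normal_base S -> S 0.
Proof. by move=> [aS _ _ _]; have [l _] := aS 0; rewrite scaler0. Qed.

Let normal_baseT : normal_base [set: V].
Proof. by split=> //; move=> v; exists 1. Qed.

Let normal_baseI (S T : set V) :
  normal_base S -> normal_base T -> normal_base (S `&` T).
Proof.
move=> bS bT; have S0 := normal_base0 bS; have T0 := normal_base0 bT.
move: bS bT => [aS bS /convex_setP cS sS] [aT bT /convex_setP cT sT].
have shrink (A : set V) (v : V) (l m : R) : balanced A -> 0 < m -> m <= l ->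
    A (l *: v) -> A (m *: v).
  move=> bA m0 ml Al; have l0 : 0 < l := lt_le_trans m0 ml.
  have -> : m *: v = (m / l) *: (l *: v) by rewrite scalerA divfK// gt_eqF.
  apply: bA => //; rewrite (le_trans (y := 0)) ?lerN10//=; last first.
    by rewrite divr_ge0// ltW.
  by rewrite ler_pdivrMr// mul1r.
split.
- move=> v; have [l l0 Sl] := aS v; have [m m0 Tm] := aT v.
  have lm0 : 0 < Num.min l m by rewrite lt_min l0.
  exists (Num.min l m) => //; split.
  + by apply: (shrink S v l) => //; rewrite ge_min lexx.
  + by apply: (shrink T v m) => //; rewrite ge_min lexx orbT.
- by move=> v l [Sv Tv] l1; split; [exact: bS | exact: bT].
- apply/convex_setP => x y t t01 [Sx Tx] [Sy Ty].
  by split; [exact: cS | exact: cT].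
- move=> l u [Sl Tl] [Su Tu] lu v luv.
  by split; [exact: (sS l u) | exact: (sT l u)].
Qed.

Let normal_baseZ (S : set V) (c : R) : 0 < c -> normal_base S ->
  normal_base [set v | S (c *: v)].
Proof.
move=> c0 [aS bS /convex_setP cS sS]; split.
- move=> v; have [l l0 Sl] := aS (c *: v).
  by exists l => //=; rewrite scalerA mulrC -scalerA.
- by move=> v l /= Sv l1; rewrite scalerA mulrC -scalerA; exact: bS.
- apply/convex_setP => x y t t01 /= Sx Sy.
  rewrite scalerDr !(scalerA c) ![c * _]mulrC -!scalerA; exact: cS.
- move=> l u /= Sl Su lu v /= /andP[lv vu].
  by apply: (sS _ _ Sl Su); rewrite /= ?ovs_leZ2l// ltW.
Qed.

Let normal_base_half (S : set V) (x y : V) : normal_base S ->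
  S (2 *: x) -> S (2 *: y) -> S (x + y).
Proof.
move=> [_ _ /convex_setP cS _] Sx Sy.
have h : 0 <= (2^-1 : R) <= 1.
  by rewrite invr_ge0 ler0n/= invf_le1// ler1n.
have := cS _ _ _ h Sx Sy.
have -> : 1 - 2^-1 = 2^-1 :> R.
  by rewrite [X in X - _]splitr mul1r addrK.
by rewrite !scalerA mulVf ?pnatr_eq0// !scale1r.
Qed.

(* normal_base is stable under finite intersections (normal_baseI), so the
   filter it generates consists of the supersets of its members. *)
Definition normal_nbhs (v : N) : set_system N :=
  filter_from (@normal_base R V) (fun S => [set w : N | S (w - v)]).

HB.instance Definition _ := hasNbhs.Build (order_normal_space V) normal_nbhs.

Let normal_nbhs_filter (v : N) : ProperFilter (nbhs v).
Proof.
apply: filter_from_proper; last first.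
  by move=> S /normal_base0 S0; exists v; rewrite /= subrr.
apply: filter_from_filter; first by exists setT; exact: normal_baseT.
by move=> S T bS bT; exists (S `&` T) => //; exact: normal_baseI.
Qed.

Let normal_nbhs_singleton (v : N) (A : set N) : nbhs v A -> A v.
Proof. by move=> [S /normal_base0 S0]; apply; rewrite /= subrr. Qed.

Let normal_nbhs_nbhs (v : N) (A : set N) : nbhs v A -> nbhs v (nbhs^~ A).
Proof.
move=> [S bS SA].
have bS2 : normal_base [set v | S (2 *: v)] by exact: normal_baseZ.
exists [set v | S (2 *: v)] => // w /= Sw.
exists [set v | S (2 *: v)] => // z /= Sz; apply: SA => /=.
by rewrite -(subrKA w); exact: normal_base_half.
Qed.

HB.instance Definition _ := Nbhs_isNbhsTopological.Build (order_normal_space V)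
  normal_nbhs_filter normal_nbhs_singleton normal_nbhs_nbhs.

Let normal_add_continuous :
  continuous (fun x : N * N => x.1 + x.2).
Proof.
move=> [x y] U [S bS SU] /=.
have bS2 : normal_base [set v | S (2 *: v)] by exact: normal_baseZ.
exists ([set z | S (2 *: (z - x))], [set z | S (2 *: (z - y))]).
  by split; exists [set v | S (2 *: v)].
move=> [a b] /= [Sa Sb]; apply: SU => /=.
by rewrite opprD addrACA; exact: normal_base_half.
Qed.

Let normal_scale_continuous :
  continuous (fun z : R^o * N => z.1 *: z.2).
Proof.
move=> [k x] U [S bS SU] /=.
have bS2 : normal_base [set v | S (2 *: v)] by exact: normal_baseZ.
have [aS2 lS2 _ _] := bS2.
have [l l0 Sl] := aS2 x.
pose c : R := `|k| + 1; have c0 : 0 < c by rewrite ltr_wpDl.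
have bSc : normal_base [set v | S (2 *: (c *: v))].
  exact: (normal_baseZ c0 bS2).
exists ([set a : R^o | `|a - k| < Num.min l 1],
        [set z | S (2 *: (c *: (z - x)))]).
  split; last by exists [set v | S (2 *: (c *: v))].
  apply/nbhs_ballP; exists (Num.min l 1); first by rewrite /= lt_min l0 ltr01.
  by move=> a; rewrite -ball_normE /= distrC.
move=> [a z] /= [+ Sz]; rewrite lt_min => /andP[al a1]; apply: SU => /=.
have -> : a *: z - k *: x = a *: (z - x) + (a - k) *: x.
  by rewrite scalerBr scalerBl addrA subrK.
have ratio (p q : R) : 0 < q -> `|p| <= q -> -1 <= p / q <= 1.
  by move=> q0 pq; rewrite -ler_norml normrM normfV (gtr0_norm q0)
    ler_pdivrMr// mul1r.
apply: normal_base_half => //.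
- have -> : a *: (z - x) = (a / c) *: (c *: (z - x)).
    by rewrite scalerA divfK// gt_eqF.
  apply: lS2 => //; apply: ratio => //.
  by rewrite -(subrK k a) addrC (le_trans (ler_normD _ _))// lerD2l ltW.
- have -> : (a - k) *: x = ((a - k) / l) *: (l *: x).
    by rewrite scalerA divfK// gt_eqF.
  by apply: lS2 => //; apply: ratio => //; exact: ltW.
Qed.

Let normal_locally_convex : exists2 B : set_system N,
  (forall b, b \in B -> convex_set b) & basis B.
Proof.
exists [set b : set N | open b /\ convex_set (b : set (convex_lmodType N))].
  by move=> b; rewrite inE => -[].
split=> [b []//|x A [S bS SA]].
pose C : set N := [set w | S (w - x)].
have /convex_setP cS : convex_set (S : set (convex_lmodType V)) by case: bS.
have bary (t : R) (a b d : V) :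
    t *: (a + d) + (1 - t) *: (b + d) = t *: a + (1 - t) *: b + d.
  by rewrite !scalerDr addrACA -[X in _ + X]scalerDl (addrC t) subrK scale1r.
exists (interior C); last first.
  by apply: subset_trans SA; exact: interior_subset.
split; last by exists S.
split; first exact: open_interior.
apply/convex_setP => a b t t01 [Sa bSa aC] [Sb bSb bC].
exists (Sa `&` Sb); first exact: normal_baseI.
move=> w /= [wa wb].
set m : V := t *: a + _ in wa wb.
have E : w - x = t *: (a + (w - m - x)) + (1 - t) *: (b + (w - m - x)) :> V.
  by rewrite bary addrA (addrC m) subrK.
suff: S (w - x : V) by [].
rewrite E; apply: cS => //.
- by have := aC (a + (w - m)); rewrite /C /= addrAC subrr add0r -addrA; apply.
- by have := bC (b + (w - m)); rewrite /C /= addrAC subrr add0r -addrA; apply.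
Qed.

(* The factory PreTopologicalLmod_isTvs only provides the uniform structure. *)
HB.instance Definition _ := PreTopologicalLmod_isTvs.Build R N
  normal_add_continuous normal_scale_continuous normal_locally_convex.
HB.instance Definition _ := PreTopologicalNmodule_isTopologicalNmodule.Build N
  normal_add_continuous.
HB.instance Definition _ := TopologicalNmodule_isTopologicalLmodule.Build R N
  normal_scale_continuous.
HB.instance Definition _ := Uniform_isTvs.Build R N normal_locally_convex.

End normal_topology.

(* Main.v *)
Require Import Defs.
From HB Require Import structures.
From mathcomp Require Import all_boot all_order all_algebra.
From mathcomp Require Import all_classical all_reals all_analysis.
From mathcomp Require Import lra.

(* For x not below 0, the Archimedean property yields an increasing sequence
   w n >= 0, absorbing V, with x below no w n. The union of the order intervals
   [- w n, w n] is then a normal 0-neighbourhood S such that - x + S misses the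
   positive cone, whence (1) -> (2).  For (3), let q y be the infimum of the
   t >= 0 such that y <= t w n for some n: the functionals below q are exactly
   the positive ones bounded by 1 on w, and q x >= 1. An extreme point omega of
   this set of functionals with omega x = q x is extremal, since
   sup_n omega (w n) is additive in omega. The extreme point is obtained
   without topology, by applying Zorn's lemma to the sublinear functionals
   p <= q whose minorants form a face of the minorants of q: a minimal such p
   is linear. *)

Set Implicit Arguments.
Unset Strict Implicit.
Unset Printing Implicit Defensive.

Import Order.TTheory GRing.Theory Num.Theory.
Import numFieldNormedType.Exports.

Local Open Scope classical_set_scope.
Local Open Scope ring_scope.

(** * Sublinear functionals and the extreme points of their sets of linear minorants *)

Section extreme_functionals.
Context {R : realType} (V : lmodType R).
Implicit Types (p q : V -> R) (a b : {scalar V}).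

Definition sublinear p : Prop :=
  (forall y z, p (y + z) <= p y + p z) /\
  (forall (t : R) y, 0 <= t -> p (t *: y) <= t * p y).

Lemma sublinear0 p : sublinear p -> p 0 = 0.
Proof.
move=> [pD pZ]; apply/eqP; rewrite eq_le; apply/andP; split.
  by have := pZ 0 0 (lexx _); rewrite scale0r mul0r.
by have := pD 0 0; rewrite addr0; lra.
Qed.

Lemma sublinearZ p t y : sublinear p -> 0 <= t -> p (t *: y) = t * p y.
Proof.
move=> sp; rewrite le_eqVlt => /predU1P[<-|t0].
  by rewrite scale0r mul0r sublinear0.
apply/le_anti; rewrite sp.2 ?(ltW t0)//=.
rewrite -ler_pdivlMl//.
rewrite -{1}[y](scalerK (lt0r_neq0 t0)); apply: sp.2.
by rewrite invr_ge0 ltW.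
Qed.

Lemma sublinear_addN p z : sublinear p -> 0 <= p z + p (- z).
Proof. by move=> sp; rewrite -(sublinear0 sp) -(subrr z); apply: sp.1. Qed.

(** Common source of sublinearity for [support], for infima of chains and for the gauge of a
    barrier. *)
Lemma sublinear_inf (E : V -> set R) :
  (forall y, has_inf (E y)) ->
  (forall y z s t, E y s -> E z t -> exists2 r, E (y + z) r & r <= s + t) ->
  (forall (t : R) y s, 0 <= t -> E y s -> exists2 r, E (t *: y) r & r <= t * s) ->
  sublinear (fun y => inf (E y)).
Proof.
move=> hE ED EZ; split=> [y z|t y] /=.
  rewrite -lerBlDr; apply: lb_le_inf; first by case: (hE y).
  move=> s Es; rewrite lerBlDr -lerBlDl.
  apply: lb_le_inf; first by case: (hE z).
  move=> u Eu; rewrite lerBlDl; have [r Er rst] := ED _ _ _ _ Es Eu.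
  by apply: le_trans rst; apply: ge_inf => //; case: (hE (y + z)).
have lbE s : E (t *: y) s -> inf (E (t *: y)) <= s.
  by apply: ge_inf; case: (hE (t *: y)).
have [[s Es] _] := hE y.
rewrite le_eqVlt => /predU1P[t0|t0].
  have [|r Er] := EZ t y s _ Es; first by rewrite -t0.
  by rewrite -t0 !mul0r t0; apply: le_trans; exact: lbE.
rewrite mulrC -ler_pdivrMr//; apply: lb_le_inf; first by exists s.
move=> u Eu; rewrite ler_pdivrMr// mulrC.
by have [r Er] := EZ t y u (ltW t0) Eu; apply: le_trans; exact: lbE.
Qed.

(** As [p z + p (- z)] is nonnegative, the hypothesis makes [p] odd; subadditivity at [- y] and
    [- z] then reverses subadditivity at [y] and [z]. *)
Lemma sublinear_odd_linear p : sublinear p ->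
  (forall z, p (- z) <= - p z) -> exists f : {scalar V}, f =1 p.
Proof.
move=> sp pN.
have pNE z : p (- z) = - p z.
  apply/eqP; rewrite eq_le pN/=.
  by have := sublinear_addN z sp; lra.
have pD y z : p (y + z) = p y + p z.
  apply/eqP; rewrite eq_le sp.1/= -lerN2 opprD -!pNE opprD.
  exact: sp.1.
have pZ0 t z : 0 <= t -> p (t *: z) = t * p z.
  move=> t0; apply/eqP; rewrite eq_le sp.2//=.
  by rewrite -lerN2 -mulrN -!pNE -scalerN sp.2.
have pL : scalar p.
  move=> t y z; rewrite pD; congr (_ + _).
  have [t0|t0] := leP 0 t; first exact: pZ0.
  rewrite -[t]opprK scaleNr pNE pZ0 ?mulNr//.
  by rewrite oppr_ge0 ltW.
pose fL := GRing.isLinear.Build _ _ _ _ p pL.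
by pose f : {scalar V} := HB.pack p fL; exists f.
Qed.

(** For linear [p] below [q], this says that [p] is an extreme point of the set of linear minorants
    of [q], since a linear functional is its own only linear minorant. *)
Definition is_face q p : Prop :=
  forall a b (s : R), 0 < s < 1 ->
    (forall y, a y <= q y) -> (forall y, b y <= q y) ->
    (forall y, s * a y + (1 - s) * b y <= p y) ->
    (forall y, a y <= p y) /\ (forall y, b y <= p y).

(* The largest sublinear functional below p taking the value - p z at - z:
   it cuts out the functionals below p that attain p at z. *)
Definition support p z y : R :=
  inf [set p (y + t *: z) - t * p z | t in [set t : R | 0 <= t]].

Lemma support_has_inf p z y : sublinear p ->
  has_inf [set p (y + t *: z) - t * p z | t in [set t : R | 0 <= t]].
Proof.
move=> sp; split; first by eexists; exists 0 => //=.
exists (- p (- y)) => _ [t /= t0 <-].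
have := sp.1 (- y) (y + t *: z); rewrite addKr sublinearZ//; lra.
Qed.

Lemma support_le p z y t : sublinear p -> 0 <= t ->
  support p z y <= p (y + t *: z) - t * p z.
Proof.
move=> sp t0; apply: ge_inf; last by exists t.
by case: (support_has_inf z y sp).
Qed.

Lemma le_support p z y r : sublinear p ->
  (forall t, 0 <= t -> r <= p (y + t *: z) - t * p z) -> r <= support p z y.
Proof.
move=> sp rp; apply: lb_le_inf; first by case: (support_has_inf z y sp).
by move=> _ [t /= t0 <-]; exact: rp.
Qed.

Lemma support_le_id p z y : sublinear p -> support p z y <= p y.
Proof.
move=> sp; have := support_le z y sp (lexx 0).
by rewrite scale0r addr0 mul0r subr0.
Qed.

Lemma supportN p z : sublinear p -> support p z (- z) <= - p z.
Proof.
move=> sp; have := support_le z (- z) sp (@ler01 R).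
by rewrite scale1r addNr sublinear0// mul1r sub0r.
Qed.

Lemma support_sublinear p z : sublinear p -> sublinear (support p z).
Proof.
move=> sp; apply: sublinear_inf => [y|y u _ _ [s /= s0 <-] [t /= t0 <-]|].
- exact: support_has_inf.
- eexists; first by exists (s + t) => //=; rewrite addr_ge0.
  rewrite scalerDl addrACA.
  by have := sp.1 (y + s *: z) (u + t *: z); lra.
- move=> t y _ t0 [s /= s0 <-].
  eexists; first by exists (t * s) => //=; rewrite mulr_ge0.
  by rewrite -scalerA -scalerDr sublinearZ// mulrBr mulrA.
Qed.

(** Evaluating the convex combination at [- z] forces [a] and [b] to agree with [p] at [z]; then
    [a y = a (y + t *: z) - t * p z] is at most each term of the infimum, and likewise for [b]. *)
Lemma support_face q p z : sublinear p -> is_face q p -> is_face q (support p z).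
Proof.
move=> sp fp a b s s01 aq bq sab.
have [ap bp] : (forall y, a y <= p y) /\ (forall y, b y <= p y).
  by apply: (fp a b s) => // y; apply: (le_trans (sab y)); exact: support_le_id.
have [s0 s1] := andP s01.
have : s * (p z - a z) + (1 - s) * (p z - b z) <= 0.
  have := le_trans (sab (- z)) (supportN z sp).
  by rewrite !linearN; lra.
have sa : 0 <= s * (p z - a z) by rewrite mulr_ge0 ?subr_ge0// ltW.
have sb : 0 <= (1 - s) * (p z - b z) by rewrite mulr_ge0 ?subr_ge0// ltW.
move=> sab0.
have /eqP : s * (p z - a z) = 0 by lra.
rewrite mulf_eq0 gt_eqF//= subr_eq0 => /eqP az.
have /eqP : (1 - s) * (p z - b z) = 0 by lra.
rewrite mulf_eq0 (gt_eqF (_ : 0 < 1 - s)) ?subr_gt0//= subr_eq0 => /eqP bz.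
split=> y; apply: le_support => // t t0; [rewrite az|rewrite bz].
  by have := ap (y + t *: z); rewrite linearD linearZ/= lerBrDr.
by have := bp (y + t *: z); rewrite linearD linearZ/= lerBrDr.
Qed.

Lemma chain_inf_face q (C : set (V -> R)) : sublinear q ->
  C !=set0 -> (forall p1 p2, C p1 -> C p2 ->
    (forall y, p1 y <= p2 y) \/ (forall y, p2 y <= p1 y)) ->
  (forall p, C p -> [/\ sublinear p, (forall y, p y <= q y) & is_face q p]) ->
  exists p, [/\ sublinear p, is_face q p & forall p', C p' -> forall y, p y <= p' y].
Proof.
move=> sq [p0 Cp0] tC hC.
have hE y : has_inf [set p y | p in C].
  split; first by exists (p0 y), p0.
  (* This bound is uniform over the chain: [- p y <= p (- y) <= q (- y)]. *)
  exists (- q (- y)) => _ [p Cp <-].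
  have [sp pq _] := hC _ Cp; have := pq (- y); have := sublinear_addN y sp; lra.
have lb p' : C p' -> forall y, inf [set p y | p in C] <= p' y.
  by move=> Cp' y; apply: ge_inf; [case: (hE y)|exists p'].
exists (fun y => inf [set p y | p in C]); split=> //.
- apply: sublinear_inf => // [y z _ _ [p1 C1 <-] [p2 C2 <-]|t y _ t0 [p Cp <-]].
  + have [[[s1 _] _ _] [[s2 _] _ _]] := (hC _ C1, hC _ C2).
    case: (tC _ _ C1 C2) => p12.
      by exists (p1 (y + z)); [exists p1|apply: le_trans (s1 _ _) _; rewrite lerD2l].
    by exists (p2 (y + z)); [exists p2|apply: le_trans (s2 _ _) _; rewrite lerD2r].
  + by have [[_ sp] _ _] := hC _ Cp; exists (p (t *: y)); [exists p|exact: sp].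
- move=> a b s s01 aq bq sab.
  have abp p : C p -> (forall y, a y <= p y) /\ (forall y, b y <= p y).
    move=> Cp; have [_ _ fp] := hC _ Cp.
    by apply: (fp a b s) => // y; apply: (le_trans (sab y)); exact: lb.
  by split=> y; (apply: lb_le_inf; first by case: (hE y));
    move=> _ [p Cp <-]; apply abp.
Qed.

Lemma extreme_functional_in_face q p0 : sublinear q -> sublinear p0 ->
  (forall y, p0 y <= q y) -> is_face q p0 ->
  exists2 f : {scalar V}, is_face q f & forall y, f y <= p0 y.
Proof.
move=> sq sp0 p0q fp0.
pose good p := [/\ sublinear p, (forall y, p y <= p0 y) & is_face q p].
pose T := {p | good p}.
(* The pointwise order is reversed, so that a maximal element for [le] is a minimal functional. *)
pose le (p1 p2 : T) := `[< forall y, sval p2 y <= sval p1 y >].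
have [||||[p [sp pp0 fp]] pmin] := @Zorn T le.
- by move=> t; apply/asboolP.
- move=> r s t /asboolP rs /asboolP st; apply/asboolP => y.
  exact: le_trans (st y) (rs y).
- move=> [s gs] [t gt] /asboolP/= st /asboolP/= ts; apply/eq_exist/funext => y.
  by apply/eqP; rewrite eq_le st ts.
- move=> A tA.
  have [[a0 Aa0]|A0] := pselect (A !=set0); last first.
    have g0 : good p0 by [].
    by exists (exist _ _ g0) => s As; exfalso; apply: A0; exists s.
  have [|p1 p2 [t1 A1 <-] [t2 A2 <-]|_ [t At <-]|p [sp fp lbp]] :=
      @chain_inf_face q [set sval t | t in A] sq.
  + by exists (sval a0), a0.
  + by case: (tA _ _ A1 A2) => /asboolP ?; [right|left].
  + case: (svalP t) => ? tp0 ?; split=> // y.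
    exact: le_trans (tp0 y) (p0q y).
  + have gp : good p.
      split=> // y; apply: (le_trans (lbp (sval a0) _ y)); first by exists a0.
      by case: (svalP a0).
    exists (exist _ _ gp) => s As; apply/asboolP => y; apply: lbp.
    by exists s.
- have [z|f fE] := sublinear_odd_linear sp; last first.
    exists f => [|y]; last by rewrite fE.
    by have -> : f = p :> (V -> R) by apply/funext.
  have gs : good (support p z).
    split; [exact: support_sublinear| |exact: support_face].
    by move=> y; apply: le_trans (support_le_id z y sp) (pp0 y).
  (* Minimality leaves no room for a smaller face, so [p] inherits [supportN] at every [z] and is
     therefore linear. *)
  have sE : support p z = p.
    apply: (congr1 sval (pmin (exist _ _ gs) _)).
    by apply/asboolP => y; exact: support_le_id.
  by rewrite -{1}sE; exact: supportN.
Qed.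

(** The search starts from the face [support q z]: a linear [f] below it has [f (- z) <= - q z],
    that is [q z <= f z]. *)
Lemma extreme_functional_attaining q z : sublinear q ->
  exists f : {scalar V}, [/\ is_face q f, forall y, f y <= q y & f z = q z].
Proof.
move=> sq.
have fq : is_face q q by move=> a b s.
have [|f ff fs] := extreme_functional_in_face sq (support_sublinear z sq) _
  (support_face sq fq).
  by move=> y; exact: support_le_id.
have fle y : f y <= q y by apply: le_trans (fs y) (support_le_id z y sq).
exists f; split=> //; apply/eqP; rewrite eq_le fle/= -lerN2 -linearN.
exact: le_trans (fs _) (supportN z sq).
Qed.

End extreme_functionals.

(** * Order inequalities, barriers, and closedness of the cone *)

Section ordered_vector_spaces.
Context {R : realType} (V : orderedVectSpace R).
Implicit Types (x y z v : V) (f : {scalar V}).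

Lemma ovs_leD x y z v : x <= y -> z <= v -> x + z <= y + v.
Proof.
move=> xy zv; apply: (@le_trans _ _ (x + v)); first exact: ovs_leD2l.
by rewrite ![_ + v]addrC; exact: ovs_leD2l.
Qed.

Lemma ovs_subr_ge0 x y : (0 <= y - x) = (x <= y).
Proof.
apply/idP/idP => [/(ovs_leD2l x)|/(ovs_leD2l (- x))].
  by rewrite addr0 addrC subrK.
by rewrite addNr addrC.
Qed.

Lemma ovs_leN2 x y : (- x <= - y) = (y <= x).
Proof. by rewrite -[LHS]ovs_subr_ge0 opprK addrC ovs_subr_ge0. Qed.

Lemma positive_functional_le f x y :
  positive_functional f -> x <= y -> f x <= f y.
Proof.
by move=> f0; rewrite -ovs_subr_ge0 => /f0; rewrite linearB subr_ge0.
Qed.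

(* w (n + 1) = w n + e_n u n, where e_n exists because x <= w n + e u n for all
   e > 0 would give x <= w n by the Archimedean property. *)
Lemma archimedean_barrier x : archimedean V -> sigma_bounded V -> ~ x <= 0 ->
  exists w : nat -> V,
    [/\ nondecreasing_seq w, forall n, 0 <= w n,
      forall v, exists n, exists2 t : R, 0 < t & - (t *: w n) <= v <= t *: w n
      & forall n, ~ x <= w n].
Proof.
move=> aV [u [_ u0 uV]] x0.
(* The step size is chosen for every pair of an index and a current element, so that the recursion
   defining [w] can call it. *)
have [e eP] : {e : nat * V -> R & forall p, 0 < e p /\
    (~ x <= p.2 -> ~ x <= p.2 + e p *: u p.1)}.
  apply: (@choice _ _ (fun p e => 0 < e /\
    (~ x <= p.2 -> ~ x <= p.2 + e *: u p.1))) => -[n y] /=.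
  have [xy|xy] := pselect (x <= y); first by exists 1; split.
  apply: contrapT => h; apply: xy.
  suff /(ovs_leD2l y) : x - y <= 0 by rewrite addr0 addrC subrK.
  apply: (aV _ (u n)) => // r r0; apply: contrapT => xr; apply: h.
  exists r; split=> // _ /(ovs_leD2l (- y)); rewrite addKr addrC.
  by apply/negP/negP.
pose w := fix w n := if n is m.+1 then w m + e (m, w m) *: u m else 0.
have step0 n : 0 <= e (n, w n) *: u n.
  have := @ovs_leZ2l _ V (e (n, w n)) 0 (u n) (ltW (eP _).1) (u0 n).
  by rewrite scaler0.
have wS n : w n <= w n.+1 by rewrite /= -{1}[w n]addr0; exact: ovs_leD2l.
have w0 n : 0 <= w n by elim: n => //= n ih; apply: le_trans (wS n).
exists w; split=> //.
- exact/nondecreasing_seqP.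
- move=> v; have [n nv] := uV v.
  exists n.+1, (e (n, w n))^-1; first by rewrite invr_gt0; exact: (eP _).1.
  have [e0 _] := eP (n, w n).
  (* The last increment alone suffices: [w n.+1] dominates [e (n, w n) *: u n] because [w n] is
     nonnegative. *)
  have uw : u n <= (e (n, w n))^-1 *: w n.+1.
    rewrite -{1}[u n](scalerK (lt0r_neq0 e0)).
    apply: ovs_leZ2l; first by rewrite invr_ge0 ltW.
    by rewrite -[leLHS]add0r; apply: ovs_leD.
  case/andP: nv => nv vn; rewrite (le_trans vn uw) andbT.
  by apply: le_trans nv; rewrite ovs_leN2.
- by elim=> [|n ih] //=; have [_] := eP (n, w n); apply.
Qed.

(** Monotonicity of [w] puts any two members in a common order interval, which yields convexity and
    saturation; absorption is the last hypothesis rescaled by [t^-1]. *)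
Lemma barrier_normal_base (w : nat -> V) :
  nondecreasing_seq w -> (forall n, 0 <= w n) ->
  (forall v, exists n, exists2 t : R, 0 < t & - (t *: w n) <= v <= t *: w n) ->
  normal_base [set v | exists n, - w n <= v <= w n].
Proof.
move=> ndw w0 aw.
have wI v n m : (n <= m)%N -> - w n <= v <= w n -> - w m <= v <= w m.
  move=> nm /andP[nv vn]; rewrite (le_trans vn (ndw _ _ nm)) andbT.
  by apply: le_trans nv; rewrite ovs_leN2; exact: ndw.
split.
- move=> v; have [n [t t0 /andP[nv vn]]] := aw v.
  have ti : 0 <= t^-1 by rewrite invr_ge0 ltW.
  exists t^-1; first by rewrite invr_gt0.
  exists n; have := ovs_leZ2l _ _ _ ti nv; have := ovs_leZ2l _ _ _ ti vn.
  by rewrite scalerN !scalerA mulVf ?gt_eqF// !scale1r => -> ->.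
- move=> v l [n /andP[nv vn]] /andP[l1 l2]; exists n.
  have key t y : 0 <= t <= 1 -> y <= w n -> t *: y <= w n.
    move=> /andP[t0 t1] yw; apply: (le_trans (ovs_leZ2l _ _ _ t0 yw)).
    rewrite -ovs_subr_ge0 -{1}[w n]scale1r -scalerBl
      -[X in X <= _](scaler0 _ (1 - t)).
    by apply: ovs_leZ2l; rewrite ?subr_ge0.
  have nvw : - v <= w n by rewrite -ovs_leN2 opprK.
  have [l0|l0] := leP 0 l.
    by rewrite key ?l0// andbT -ovs_leN2 opprK -scalerN key ?l0.
  have nl : 0 <= - l <= 1 by rewrite oppr_ge0 ltW// lerNl.
  rewrite -[l *: v]opprK -scaleNr -scalerN key// andbT.
  by rewrite -ovs_leN2 scalerN !opprK key.
- move=> x y l /[!inE] -[n xn] [m ym]; exists (maxn n m).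
  have := wI _ _ _ (leq_maxl n m) xn; have := wI _ _ _ (leq_maxr n m) ym.
  move: (maxn n m) => k /andP[y1 y2] /andP[x1 x2].
  have l0 : 0 <= l%:num by [].
  have l1 : 0 <= 1 - l%:num by rewrite subr_ge0.
  have cw z : l%:num *: z + (1 - l%:num) *: z = z.
    by rewrite -scalerDl addrC subrK scale1r.
  apply/andP; split.
    by rewrite -(cw (- w k)); apply: ovs_leD; exact: ovs_leZ2l.
  by rewrite -(cw (w k)); apply: ovs_leD; exact: ovs_leZ2l.
- move=> l u [n nl] [m mu] _ v /= /andP[lv vu]; exists (maxn n m).
  have /andP[l1 _] := wI _ _ _ (leq_maxl n m) nl.
  have /andP[_ u2] := wI _ _ _ (leq_maxr n m) mu.
  by rewrite (le_trans l1 lv) (le_trans vu u2).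
Qed.

Lemma archimedean_closed : sigma_bounded V -> archimedean V ->
  closed (positive_cone V : set (order_normal_space V)).
Proof.
move=> sV aV v cv; apply: contrapT => v0.
have [|w [ndw w0 aw xw]] := @archimedean_barrier (- v) aV sV.
  by rewrite -oppr0 ovs_leN2.
have [|z [pz [n /andP[_ zn]]]] :=
    cv [set z : V | exists n, - w n <= z - v <= w n].
  by exists [set v | exists n, - w n <= v <= w n] => //; exact: barrier_normal_base.
(* From [0 <= z] follows [- v <= z - v <= w n], which the barrier forbids. *)
apply: (xw n); apply: le_trans zn.
by rewrite -[leLHS]add0r; apply: ovs_leD.
Qed.

(** An absorbing set contains some [l *: w] with [0 < l], so the positive elements [l *: w - v] meet
    every neighbourhood of [- v]. *)
Lemma closed_archimedean :
  closed (positive_cone V : set (order_normal_space V)) -> archimedean V.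
Proof.
move=> cV v w w0 vw.
rewrite -oppr0 -[v]opprK ovs_leN2; apply: cV => A [S [aS _ _ _] SA].
have [l l0 Sl] := aS w.
exists (l *: w - v); split; first by rewrite /positive_cone/= ovs_subr_ge0 vw.
by apply: SA; rewrite /= opprK subrK.
Qed.

Lemma induced_archimedean :
  order_induced_by (positive_functional (V := V)) -> archimedean V.
Proof.
move=> oV v w w0 vw; apply: contrapT => v0.
have [|f f0] := oV (- v).
  by rewrite /positive_cone/= -oppr0 ovs_leN2.
rewrite linearN oppr_lt0 => fv.
have fw e : 0 < e -> f v <= e * f w.
  by move=> /vw/(positive_functional_le f0); rewrite linearZ.
have fw0 : 0 <= f w := f0 _ w0.
(* This [e] makes [e * f w] smaller than [f v]; the summand [1] covers the case [f w = 0]. *)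
have := fw (f v / (f w + 1) / 2); rewrite !divr_gt0 ?ltr_wpDl// => /(_ isT).
have fw1 : 0 < f w + 1 by lra.
rewrite mulrAC ler_pdivlMr// mulrAC ler_pdivlMr// leNgt => /negP; apply.
nra.
Qed.

(** * The gauge of a barrier and extremal functionals *)

Section gauge.
Context (w : nat -> V) (ndw : nondecreasing_seq w) (w0 : forall n, 0 <= w n).
Context (aw : forall v, exists n,
  exists2 t : R, 0 < t & - (t *: w n) <= v <= t *: w n).

Let E y := [set t : R | 0 <= t /\ exists n, y <= t *: w n].

Let gauge y := inf (E y).

Let gauge_has_inf y : has_inf (E y).
Proof.
split; last by exists 0 => t [].
by have [n [t t0 /andP[_ yt]]] := aw y; exists t; split; [exact: ltW|exists n].
Qed.

Let gauge_sublinear : sublinear gauge.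
Proof.
apply: sublinear_inf => //.
- move=> y z s t [s0 [n yn]] [t0 [m zm]].
  exists (s + t) => //; split; first exact: addr_ge0.
  exists (maxn n m); rewrite scalerDl; apply: ovs_leD.
    by apply: (le_trans yn); apply: ovs_leZ2l => //; apply/ndw/leq_maxl.
  by apply: (le_trans zm); apply: ovs_leZ2l => //; apply/ndw/leq_maxr.
- move=> t y s t0 [s0 [n yn]]; exists (t * s) => //; split; first exact: mulr_ge0.
  by exists n; rewrite -scalerA; exact: ovs_leZ2l.
Qed.

Let gauge_le y t n : 0 <= t -> y <= t *: w n -> gauge y <= t.
Proof.
by move=> t0 yt; apply: ge_inf; [case: (gauge_has_inf y)|split=> //; exists n].
Qed.

Let gauge_ge1 x : (forall n, ~ x <= w n) -> 1 <= gauge x.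
Proof.
move=> xw; apply: lb_le_inf; first by case: (gauge_has_inf x).
move=> t [t0 [n xn]]; rewrite leNgt; apply/negP => t1.
apply: (xw n); apply: (le_trans xn).
rewrite -ovs_subr_ge0 -{1}[w n]scale1r -scalerBl
  -[X in X <= _](scaler0 _ (1 - t)).
by apply: ovs_leZ2l; rewrite ?subr_ge0// ltW.
Qed.

Let le_gauge f : positive_functional f -> (forall n, f (w n) <= 1) ->
  forall y, f y <= gauge y.
Proof.
move=> f0 fw y; apply: lb_le_inf; first by case: (gauge_has_inf y).
move=> t [t0 [n yn]]; apply: (le_trans (positive_functional_le f0 yn)).
by rewrite linearZ/= ler_piMr.
Qed.

(** Every [y] lies below a positive multiple of some [w n], so [f] is nonpositive at both [y] and
    [- y]. *)
Let positive_functional_eq0 f : positive_functional f ->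
  (forall n, f (w n) <= 0) -> forall y, f y = 0.
Proof.
move=> f0 fw.
have fle y : f y <= 0.
  have [n [t t0 /andP[_ yt]]] := aw y.
  apply: (le_trans (positive_functional_le f0 yt)).
  by rewrite linearZ/= pmulr_rle0.
by move=> y; apply/le_anti; rewrite fle/= -oppr_le0 -linearN.
Qed.

Let scale_functional f (c : R) : exists g : {scalar V}, forall y, g y = c * f y.
Proof.
have gL : scalar (fun y => c * f y).
  by move=> t y z; rewrite linearD linearZ/= mulrDr mulrCA.
pose fL := GRing.isLinear.Build _ _ _ _ (fun y => c * f y) gL.
by pose g : {scalar V} := HB.pack (fun y => c * f y) fL; exists g.
Qed.

(* If rho <= omega, then a := sup (rho (w n)) and 1 - a bound rho and
   omega - rho on w, so that omega = a (rho / a) + (1 - a) ((omega - rho) / (1 - a))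
   is a convex combination of functionals below the gauge. *)
Let face_extremal omega : positive_functional omega ->
  (forall y, omega y <= gauge y) -> is_face gauge omega ->
  extremal_functional omega.
Proof.
move=> omega0 og fo; split=> // rho rho0 rho_le.
have ow n : omega (w n) <= 1.
  by apply: (le_trans (og _)); apply: (@gauge_le _ _ n) => //; rewrite scale1r.
(* Both [rho] and [omega - rho] increase along [w], so they may be compared at the larger index,
   where their sum is at most 1. *)
have rw n m : rho (w n) <= 1 - (omega (w m) - rho (w m)).
  have h k l : (k <= l)%N -> rho (w k) <= rho (w l).
    by move=> kl; apply: (positive_functional_le rho0); exact: ndw.
  have h' k l : (k <= l)%N -> omega (w k) - rho (w k) <= omega (w l) - rho (w l).
    by move=> kl; apply: (positive_functional_le rho_le); exact: ndw.
  have := h n _ (leq_maxl n m); have := h' m _ (leq_maxr n m).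
  by have := ow (maxn n m); lra.
pose a := sup (range (rho \o w)).
have hub : has_ubound (range (rho \o w)).
  by exists (1 - (omega (w 0) - rho (w 0))) => _ [n _ <-]; exact: rw.
have ra n : rho (w n) <= a by apply: ub_le_sup => //; exists n.
have sa n : omega (w n) - rho (w n) <= 1 - a.
  rewrite lerBrDl -lerBrDr; apply: ge_sup; first by exists (rho (w 0)), 0.
  by move=> _ [m _ <-]; exact: rw.
have a0 : 0 <= a by apply: le_trans (ra 0); exact: (rho0 _ (w0 0)).
have a1 : 0 <= 1 - a by apply: le_trans (sa 0); exact: (rho_le _ (w0 0)).
(* The cases [a = 0] and [a = 1], where one of the divisions fails, make [rho] or [omega - rho]
   vanish. *)
move: a0; rewrite le_eqVlt => /predU1P[a0|a0].
  exists 0; first by rewrite lexx ler01.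
  by move=> v; rewrite mul0r; apply: positive_functional_eq0 => // n; rewrite a0.
move: a1; rewrite le_eqVlt => /predU1P[a1|a1].
  exists 1; first by rewrite lexx ler01.
  move=> v; rewrite mul1r; apply/esym/eqP; rewrite -subr_eq0; apply/eqP.
  by apply: (positive_functional_eq0 rho_le) => n; rewrite a1; exact: sa.
have [r1 r1E] := scale_functional rho a^-1.
have [r2 r2E] := scale_functional (omega \- rho) (1 - a)^-1.
exists a; first by rewrite ltW//= -subr_ge0 ltW.
have [|y|y|y|r1o _] := fo r1 r2 a.
- by rewrite a0 -subr_gt0.
- apply: le_gauge => [v v0|n]; rewrite r1E.
    by rewrite mulr_ge0 ?invr_ge0 ?(ltW a0)//; exact: rho0.
  by rewrite mulrC ler_pdivrMr// mul1r.
- apply: le_gauge => [v v0|n]; rewrite r2E.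
    by rewrite mulr_ge0 ?invr_ge0 ?(ltW a1)//; exact: rho_le.
  by rewrite mulrC ler_pdivrMr// mul1r; exact: sa.
- by rewrite r1E r2E !mulVKf ?gt_eqF//= addrC subrK.
move=> v.
(* For linear functionals [r1 <= omega] is already equality, by evaluation at [- v]. *)
have <- : r1 v = omega v.
  by apply/le_anti; rewrite r1o/= -lerN2 -!linearN.
by rewrite r1E mulVKf ?gt_eqF.
Qed.

Lemma barrier_extremal_functional x : (forall n, ~ x <= w n) ->
  exists2 omega : {scalar V}, extremal_functional omega & 0 < omega x.
Proof.
move=> xw.
have [f [ff fg fx]] := extreme_functional_attaining x gauge_sublinear.
exists f; last by rewrite fx (lt_le_trans ltr01)//; exact: gauge_ge1.
(* Positivity of [f]: since [- v <= 0 *: w 0], the gauge of [- v] is at most 0. *)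
apply: face_extremal => // v v0; rewrite -oppr_le0 -linearN.
apply: (le_trans (fg _)); apply: (@gauge_le _ _ 0) => //.
by rewrite scale0r -oppr0 ovs_leN2.
Qed.

End gauge.

Lemma archimedean_induced_extremal : sigma_bounded V -> archimedean V ->
  order_induced_by (extremal_functional (V := V)).
Proof.
move=> sV aV v v0.
have [|w [ndw w0 aw xw]] := @archimedean_barrier (- v) aV sV.
  by rewrite -oppr0 ovs_leN2.
have [f ef fv] := barrier_extremal_functional ndw w0 aw xw.
by exists f; rewrite // -oppr_gt0 -linearN.
Qed.

End ordered_vector_spaces.

Theorem theorem3p9 (R : realType) (V : orderedVectSpace R) :
  sigma_bounded V ->
  [<-> archimedean V;
       closed (positive_cone V : set (order_normal_space V));
       order_induced_by (extremal_functional (V := V));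
       order_induced_by (positive_functional (V := V))].
Proof.
move=> sV; tfae.
- exact: archimedean_closed.
(* Closedness yields extremal functionals by way of the Archimedean property. *)
- by move=> /closed_archimedean; exact: archimedean_induced_extremal.
- by move=> oV v /oV[f [f0 _] fv]; exists f.
- exact: induced_archimedean.
Qed.
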